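(* Let $p_N^{\mathrm{FEP}}(t)$ be the maximal transience probability at time $t$ of the facilitated exclusion process on the ring with $N$ sites. Then $$\lim_{t\to\infty}\ \sup_{N\ge2}\ p_N^{\mathrm{FEP}}\big(tN^2\log N\big)=0 .$$
   Context: For $N\ge1$ let $\mathbb{T}_N=\{1,\dots,N\}$ be the periodic ring (indices mod $N$) and $\Sigma_N=\{0,1\}^{\mathbb{T}_N}$. The facilitated exclusion process (FEP) on $\mathbb{T}_N$ is the continuous-time Markov process on $\Sigma_N$ with generator $$\mathscr{L}_N f(\eta)=\sum_{x\in\mathbb{T}_N}c_{x,x+1}(\eta)\{f(\eta^{x,x+1})-f(\eta)\},\qquad c_{x,x+1}(\eta)=\eta_{x-1}\eta_x(1-\eta_{x+1})+(1-\eta_x)\eta_{x+1}\eta_{x+2},$$ where $\eta^{x,x+1}$ is $\eta$ with the values at $x$ and $x+1$ exchanged. Let $\mathbb{P}^N_\eta$ be its law started from $\eta$, and $|\eta|=\sum_x\eta_x$. Frozen configurations: $\mathcal{F}_N^{\mathrm{FEP}}=\{\eta\in\Sigma_N:\eta_x\eta_{x+1}=0\ \forall x\}$. Ergodic configurations: $\mathcal{E}_N^{\mathrm{FEP}}=\{\eta\in\Sigma_N:(1-\eta_x)(1-\eta_{x+1})=0\ \forall x\}$. Transient configurations: $\mathcal{T}_N^{\mathrm{FEP}}=\{\eta\in\Sigma_N\setminus\mathcal{F}_N^{\mathrm{FEP}}:|\eta|\le N/2\}\cup\{\eta\in\Sigma_N\setminus\mathcal{E}_N^{\mathrm{FEP}}:|\eta|\ge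 N/2\}$. Let $p_\eta(t)=\mathbb{P}^N_\eta(\eta(t)\in\mathcal{T}_N^{\mathrm{FEP}})$ and $p_N^{\mathrm{FEP}}(t)=\sup\{p_\eta(t):\eta\in\Sigma_N\}$. *)

(* Defs.v *)
From HB Require Import structures.
From mathcomp Require Import all_boot all_order all_fingroup all_algebra.
From mathcomp Require Import all_classical all_reals all_analysis.
Set Implicit Arguments.
Unset Strict Implicit.
Unset Printing Implicit Defensive.
Import Order.TTheory GRing.Theory Num.Theory.
Import numFieldNormedType.Exports.
Local Open Scope classical_set_scope.
Local Open Scope ring_scope.

(** * Continuous-time Markov processes on a finite state space *)

Section MarkovProcess.
Context {d : measure_display} {Omega : measurableType d} {R : realType}.
Context {S : finType}.

Definition natural_filtration (X : R -> Omega -> S) (s : R) : set (set Omega) :=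
  <<s [set A | exists (u : R) (B : set S), 0 <= u <= s /\ A = X u @^-1` B] >>.

(** [X] is the process and [P eta] the law under which it starts from [eta]
    (all laws live on the same measurable space).  A subset of the finite set
    [S] is measurable, so [markov_property] is the defining identity of
    [P eta (X (s + t) \in B | F_s) = P (X s) (X t \in B)], where [F_s] is the
    natural filtration. Only times [t >= 0] are constrained. *)
Record markov_process (L : (S -> R) -> S -> R) (X : R -> Omega -> S)
    (P : S -> probability Omega R) : Prop := MarkovProcess {
  markov_measurable : forall (t : R) (B : set S), 0 <= t ->
    measurable (X t @^-1` B) ;
  markov_right_continuous : forall w (t : R), 0 <= t ->
    \forall s \near t^'+, X s w = X t w ;
  markov_left_limit : forall w (t : R), 0 < t ->
    exists xi, \forall s \near t^'-, X s w = xi ;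
  markov_start : forall eta, P eta (X 0 @^-1` [set eta]) = 1%E ;
  markov_property : forall eta (s t : R) (A : set Omega) (B : set S),
    0 <= s -> 0 <= t -> natural_filtration X s A ->
    P eta (A `&` X (s + t) @^-1` B)
      = (\int[P eta]_(w in A) P (X s w) (X t @^-1` B))%E ;
  markov_generator : forall (f : S -> R) eta,
    (fine 'E_(P eta)[f \o X h] - f eta) / h @[h --> 0^'+] --> L f eta
}.

End MarkovProcess.

(** * The facilitated exclusion process *)

(** Sites are numbered [0, ..., N-1]; [ordS] and [ord_pred] are [x + 1] and
    [x - 1] modulo [N]. *)
Definition config (N : nat) := {ffun 'I_N -> bool}.

Section FEP.
Context {N : nat}.
Implicit Types (eta : config N) (x : 'I_N).

Definition swap eta x : config N := [ffun y => eta (tperm x (ordS x) y)].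

Definition nb_particles eta : nat := (\sum_x eta x)%N.

Definition rate {R : realType} eta x : R :=
  let e y : R := (eta y)%:R in
  e (ord_pred x) * e x * (1 - e (ordS x))
  + (1 - e x) * e (ordS x) * e (ordS (ordS x)).

Definition FEP_generator {R : realType} (f : config N -> R) eta : R :=
  \sum_x rate eta x * (f (swap eta x) - f eta).

Definition frozen : set (config N) :=
  [set eta : config N | forall x, (eta x * eta (ordS x) = 0)%N].

Definition ergodic : set (config N) :=
  [set eta : config N | forall x, ((1 - eta x) * (1 - eta (ordS x)) = 0)%N].

(** [|eta| <= N / 2] is written [2 * |eta| <= N] since division on [nat]
    truncates. *)
Definition transient : set (config N) :=
  [set eta : config N | ~ frozen eta /\ (2 * nb_particles eta <= N)%N]
  `|` [set eta : config N | ~ ergodic eta /\ (N <= 2 * nb_particles eta)%N].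

End FEP.

Definition transience_proba {d : measure_display} {Omega : measurableType d}
    {R : realType} {N : nat} (X : R -> Omega -> config N)
    (P : config N -> probability Omega R) (eta : config N) (t : R) : \bar R :=
  P eta (X t @^-1` transient).

Definition max_transience_proba {d : measure_display}
    {Omega : measurableType d} {R : realType} {N : nat}
    (X : R -> Omega -> config N) (P : config N -> probability Omega R)
    (t : R) : \bar R :=
  ereal_sup [set transience_proba X P eta t | eta in [set: config N]].

(* Main.v *)
Require Import Defs.
From mathcomp Require Import all_boot all_order all_fingroup all_algebra.
From mathcomp Require Import all_classical all_reals all_analysis.
From mathcomp Require Import zify ring lra.
Import Order.TTheory GRing.Theory Num.Theory.
Import numFieldNormedType.Exports.
Local Open Scope classical_set_scope.
Local Open Scope ring_scope.
Set Implicit Arguments.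
Unset Strict Implicit.
Unset Printing Implicit Defensive.

(** The proof exhibits a Lyapunov function.  Call two neighbouring empty
    sites a hole pair and two neighbouring occupied sites a particle pair.
    Particle pairs are the mobile excess of the process, hole pairs are traps
    which an excess particle fills on arrival.  A transient configuration has
    at least one pair of each kind ([transient_pairs], a counting argument).

    A hole pair does not move: it stays at the same two sites until a particle
    jumps into it, and no jump creates one ([hole_pair_swap]).  So fix a hole
    pair at sites [x], [x + 1] and cut the ring there.  A particle leaving a
    cluster moves a particle pair two sites away, or destroys it if it meets
    another trap.  Give the particle pair at distance [k] from [x] the weight
    [k (N - k)], which is concave and vanishes at the cut.  Summing over the
    two ends of all clusters and summing by parts, the generator decreases the
    total weight seen from [x] at rate at least four times the number of
    particle pairs: a cluster contributes in proportion to its length although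
    it only moves at its ends, because its two ends are far apart and the
    increments of a concave weight there differ accordingly.  As each weight
    is at most [N ^ 2], the [potential] [V], which is the sum over all hole
    pairs [x] of the total weight seen from [x], satisfies
    [L V <= - (4 / N ^ 2) V] ([generator_potential]).

    Hence the expectation of [V] at time [s] is at most
    [exp (- 4 s / N ^ 2) N ^ 4] ([transition_decay]).  Since [V] is at least
    [1] on transient configurations, this also bounds the transience
    probability; at [s = t N ^ 2 ln N] the bound is [N ^ (4 - 4 t)], hence at
    most [2 ^ (4 - 4 t)] uniformly in [N >= 2] as soon as [t >= 1]. *)

(** * Transition semigroup of a finite Markov process *)

Lemma integral_finite_valued (d : measure_display) (T : measurableType d)
    (R : realType) (S : finType) (mu : {finite_measure set T -> \bar R})
    (Y : T -> S) (g : S -> R) :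
  (forall B : set S, measurable (Y @^-1` B)) ->
  (\int[mu]_w (g (Y w))%:E)%E
    = (\sum_xi g xi * fine (mu (Y @^-1` [set xi])))%:E.
Proof.
move=> mY.
have gE w : (g (Y w))%:E = (\sum_xi (g xi)%:E * (\1_(Y @^-1` [set xi]) w)%:E)%E.
  rewrite (bigD1 (Y w)) //= big1 ?adde0 => [|xi xiY].
    by rewrite indicE mem_set // mule1.
  by rewrite indicE memNset ?mule0 //= => e; rewrite e eqxx in xiY.
have ig xi : mu.-integrable setT (fun w => (\1_(Y @^-1` [set xi]) w)%:E).
  exact: integrable_indic.
under eq_integral do rewrite gE.
rewrite integral_sum //; last by move=> xi; exact: integrableZl.
rewrite -sumEFin; apply: eq_bigr => xi _.
rewrite integralZl // integral_indic // setIT EFinM fineK //.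
exact: fin_num_measure.
Qed.

Section Semigroup.
Context {d : measure_display} {Omega : measurableType d} {R : realType}.
Context {S : finType} {L : (S -> R) -> S -> R} {X : R -> Omega -> S}.
Context {P : S -> probability Omega R} (MP : markov_process L X P).

Definition transition (t : R) (f : S -> R) (eta : S) : R :=
  \sum_xi f xi * fine (P eta (X t @^-1` [set xi])).

Lemma expectation_transition (t : R) (f : S -> R) (eta : S) : 0 <= t ->
  ('E_(P eta)[f \o X t] = (transition t f eta)%:E)%E.
Proof.
move=> t0.
have mX B : measurable (X t @^-1` B) by exact: (markov_measurable MP).
by rewrite unlock (integral_finite_valued (P eta) f mX).
Qed.

Lemma transition_event (t : R) (B : set S) (eta : S) : 0 <= t ->
  P eta (X t @^-1` B) = (transition t (\1_B) eta)%:E.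
Proof.
move=> t0.
have mX C : measurable (X t @^-1` C) by exact: (markov_measurable MP).
rewrite -(integral_finite_valued (P eta) (\1_B) mX) -(setIT (X t @^-1` B)).
by rewrite -integral_indic.
Qed.

Lemma transition_le (t : R) (f g : S -> R) (eta : S) :
  (forall xi, f xi <= g xi) -> transition t f eta <= transition t g eta.
Proof.
by move=> fg; apply: ler_sum => xi _; rewrite ler_wpM2r // fine_ge0.
Qed.

Lemma transition_affine (t a b : R) (f : S -> R) (eta : S) : 0 <= t ->
  transition t (fun xi => a * f xi + b) eta = a * transition t f eta + b.
Proof.
move=> t0; have mass1 : transition t (\1_setT) eta = 1.
  by apply: EFin_inj; rewrite -transition_event // preimage_setT
    probability_setT.
rewrite -[b in RHS]mulr1 -mass1 /transition !mulr_sumr -big_split /=.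
by apply: eq_bigr => xi _; rewrite indicE in_setT mul1r mulrDl mulrA.
Qed.

Lemma transitionD (s t : R) (f : S -> R) (eta : S) : 0 <= s -> 0 <= t ->
  transition (s + t) f eta = transition s (transition t f) eta.
Proof.
move=> s0 t0; rewrite {2}/transition.
under [RHS]eq_bigr do rewrite mulr_suml.
rewrite exchange_big /=; apply: eq_bigr => xi _.
under eq_bigr do rewrite -mulrA.
rewrite -mulr_sumr; congr (_ * _).
have FT : natural_filtration X s setT.
  by move=> M /= [[M0 MC _] _]; rewrite -(setD0 setT); exact: MC.
have := markov_property MP eta [set xi] s0 t0 FT; rewrite setTI => ->.
rewrite (eq_integral
  (fun w => (fine (P (X s w) (X t @^-1` [set xi])))%:E)) => [|w _].
  have mX C : measurable (X s @^-1` C) by exact: (markov_measurable MP).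
  by rewrite (integral_finite_valued (P eta)
    (fun zeta => fine (P zeta (X t @^-1` [set xi]))) mX).
by rewrite fineK // fin_num_measure //; exact: (markov_measurable MP).
Qed.

(** One step of an Euler scheme.  The error [e] is additive: no multiplicative
    error would do, since [f] may vanish at some states. *)
Lemma transition_step (c e : R) (f : S -> R) : 0 < e ->
  (forall xi, L f xi <= - c * f xi) ->
  \forall h \near 0^'+, forall xi,
    transition h f xi <= (1 - c * h) * f xi + e * h.
Proof.
move=> e0 Lf.
have : \forall h \near 0^'+, forall xi : S,
    (fine ('E_(P xi)[f \o X h])%E - f xi) / h < L f xi + e.
  apply: (@filter_forall _ _ _ _ _).
  move=> xi; have /cvgrPdist_lt/(_ e e0) :=
    @markov_generator _ _ _ _ _ _ _ MP f xi.
  apply: filterS => h; rewrite distrC => /(le_lt_trans (ler_norm _)).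
  by rewrite ltrBlDl.
have := nbhs_right_gt (0 : R); apply: filterS2 => h h0 + xi => /(_ xi).
rewrite expectation_transition ?(ltW h0) //= ltr_pdivrMr // => lt.
have := Lf xi; nra.
Qed.

(** The [n + 1] additive errors simply add up, because the factor [1 - c h]
    lies between [0] and [1]. *)
Lemma transition_iter (c e h : R) (f : S -> R) (n : nat) (eta : S) :
  0 <= e -> 0 <= h -> 0 <= c -> c * h <= 1 ->
  (forall xi, transition h f xi <= (1 - c * h) * f xi + e * h) ->
  transition (n.+1%:R * h) f eta
    <= (1 - c * h) ^+ n.+1 * f eta + n.+1%:R * (e * h).
Proof.
move=> e0 h0 c0 ch1 step; elim: n eta => [|n IHn] eta.
  by rewrite expr1 !mul1r.
have -> : n.+2%:R * h = h + n.+1%:R * h by rewrite mulrSr mulrDl mul1r addrC.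
rewrite transitionD // ?mulr_ge0 //.
apply: le_trans (transition_le _ _ IHn) _.
rewrite transition_affine //.
rewrite [(1 - c * h) ^+ n.+2]exprSr; set a := (1 - c * h) ^+ n.+1.
have a0 : 0 <= a by rewrite exprn_ge0 // subr_ge0.
have a1 : a <= 1 by rewrite exprn_ile1 // ?subr_ge0 // gerBl mulr_ge0.
rewrite [n.+2%:R]mulrSr [(_ + 1) * (e * h)]mulrDl mul1r.
rewrite [in leRHS](addrC (_ * (e * h))) addrA lerD2r -mulrA.
apply: le_trans (ler_wpM2l a0 (step eta)) _.
by rewrite mulrDr lerD2l ler_piMl // mulr_ge0.
Qed.

(** Gronwall's inequality.  Cutting [0, t] into [n + 1] steps of an Euler
    scheme gives [(1 - c t / (n + 1)) ^ (n + 1) f + e], which spares any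
    regularity in time of the semigroup. *)
Lemma transition_decay (c t : R) (f : S -> R) (eta : S) :
  0 <= c -> 0 < t -> (forall xi, 0 <= f xi) ->
  (forall xi, L f xi <= - c * f xi) ->
  transition t f eta <= expR (- (c * t)) * f eta.
Proof.
move=> c0 t0 f0 Lf; apply/ler_addgt0Pr => e e0.
have et0 : 0 < e / t by rewrite divr_gt0.
have c1 : 0 < (c + 1)^-1 by rewrite invr_gt0 ltr_wpDl.
have /= [del del0 near] :=
  filterI (transition_step et0 Lf) (nbhs_right_le c1).
(* enough steps for their length [t / (n + 1)] to be below [del] *)
set n := Num.bound (t / del).
have n0 : n.+1%:R != 0 :> R by [].
have [step ch1] : (forall xi, transition (t / n.+1%:R) f xi
     <= (1 - c * (t / n.+1%:R)) * f xi + e / t * (t / n.+1%:R))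
  /\ c * (t / n.+1%:R) <= 1.
  have [||step le1] := near (t / n.+1%:R); last first.
  - split=> //; apply: le_trans (ler_wpM2l c0 le1) _.
    by rewrite ler_pdivrMr ?mul1r ?lerDl // ltr_wpDl.
  - by rewrite /= divr_gt0.
  rewrite /= sub0r normrN gtr0_norm ?divr_gt0 // ltr_pdivrMr //.
  rewrite mulrC -ltr_pdivrMr //; apply: lt_trans (archi_boundP _) _.
    by rewrite divr_ge0 // ltW.
  by rewrite ltr_nat.
have := transition_iter (h := t / n.+1%:R) n eta (ltW et0) _ c0 ch1 step.
rewrite mulrCA divff // mulr1 => /(_ _)/le_trans; apply.
  by rewrite divr_ge0 // ltW.
have -> : n.+1%:R * (e / t * (t / n.+1%:R)) = e.
  move: n.+1%:R n0 => m m0; field.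
  by rewrite m0 gt_eqF.
rewrite lerD2r ler_wpM2r //.
have -> : - (c * t) = n.+1%:R * - (c * (t / n.+1%:R)).
  by move: n.+1%:R n0 => m m0; field.
rewrite expRM_natl lerXn2r ?nnegrE ?subr_ge0 ?expR_ge0 //.
exact: expR_ge1Dx.
Qed.

End Semigroup.

(** * Coordinates on the ring seen from a site *)

Definition site {N : nat} (x : 'I_N) (k : nat) : 'I_N := iter k (@ordS N) x.

Lemma siteS (N : nat) (x : 'I_N) (k : nat) : site x k.+1 = ordS (site x k).
Proof. by []. Qed.

Lemma val_site (N : nat) (x : 'I_N) (k : nat) :
  site x k = ((x + k) %% N)%N :> nat.
Proof.
elim: k => [|k IHk]; first by rewrite addn0 modn_small.
by rewrite siteS /= IHk -addn1 modnDml addn1 addnS.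
Qed.

Lemma site_eq (N : nat) (x : 'I_N) (j k : nat) : (j < N)%N -> (k < N)%N ->
  (site x j == site x k) = (j == k).
Proof.
move=> jN kN; rewrite -val_eqE /= !val_site eqn_modDl.
by rewrite !modn_small.
Qed.

Lemma site_size (N : nat) (x : 'I_N) : site x N = x.
Proof. by apply: val_inj; rewrite /= val_site modnDr modn_small. Qed.

Lemma sum_site (V : nmodType) (N : nat) (x : 'I_N) (F : 'I_N -> V) :
  \sum_z F z = \sum_(k < N) F (site x k).
Proof.
rewrite (reindex (fun k : 'I_N => site x k)) //.
apply/onW_bij/injF_bij => j k /eqP; rewrite site_eq // => /eqP.
exact: val_inj.
Qed.

Lemma siteP (N : nat) (x y : 'I_N) : exists k : 'I_N, y = site x k.
Proof.
have inj : injective (fun k : 'I_N => site x k).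
  by move=> j k /eqP; rewrite site_eq // => /eqP; apply: val_inj.
by exists (invF inj y); rewrite (f_invF inj y).
Qed.

(** * Effect of a jump on hole pairs and particle pairs *)

Section Jumps.
Context {N : nat}.
Implicit Types (eta : config N) (x y z : 'I_N).

Definition jump_right eta z : bool :=
  [&& eta (ord_pred z), eta z & ~~ eta (ordS z)].

Definition jump_left eta z : bool :=
  [&& ~~ eta z, eta (ordS z) & eta (ordS (ordS z))].

Definition hole_pair eta x : bool := ~~ eta x && ~~ eta (ordS x).

Definition particle_pair eta y : bool := eta y && eta (ordS y).

Lemma rateE (R : realType) eta z :
  rate eta z = (jump_right eta z)%:R + (jump_left eta z)%:R :> R.
Proof.
by rewrite /rate /jump_right /jump_left; do 4?case: (eta _) => //=; ring.
Qed.

Lemma swapE eta z y : swap eta z y =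
  if y == z then eta (ordS z) else if y == ordS z then eta z else eta y.
Proof.
rewrite ffunE; case: tpermP => [->|->|/eqP/negPf -> /eqP/negPf -> //].
  by rewrite eqxx.
by rewrite eqxx; case: eqP => // ->.
Qed.

(** Traps are never created: an allowed jump empties a site whose two
    neighbours are then occupied. *)
Lemma hole_pair_swap eta x z : jump_right eta z || jump_left eta z ->
  hole_pair (swap eta z) x -> hole_pair eta x.
Proof.
rewrite /jump_right /jump_left /hole_pair !swapE => jz.
have [->|xz] := eqVneq x z.
  by rewrite eqxx; case: eqP => [->|_]; move: (eta _) (eta (ordS z)) => [] [].
have [->|xSz] := eqVneq x (ordS z).
  have [->|SSz] := eqVneq (ordS (ordS z)) z; first by rewrite andbC.
  have [e|_] := eqVneq (ordS (ordS z)) (ordS z).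
    by rewrite !(ordS_inj e) eqxx in SSz.
  by move: jz; do 4?case: (eta _).
have [Sxz|Sxz] := eqVneq (ordS x) z.
  have -> : x = ord_pred z by rewrite -Sxz ordSK.
  by rewrite ord_predK; move: jz; do 4?case: (eta _).
by rewrite (inj_eq (@ordS_inj N)) (negPf xz).
Qed.

(** The pair made by the jumping particle and the one behind it is lost; a new
    one appears at [z + 1], [z + 2] only if site [z + 2] is occupied, hence an
    inequality.  Adding the two indicators rather than subtracting them
    keeps the statement in [nat]. *)
Lemma particle_pair_right eta z y : jump_right eta z ->
  (particle_pair (swap eta z) y + (y == ord_pred z)
    <= particle_pair eta y + (y == ordS z))%N.
Proof.
rewrite /jump_right /particle_pair !swapE => /and3P[ep ez /negPf eS].
have [->|ySz] := eqVneq y (ordS z).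
  have [e|_] := eqVneq (ordS z) (ord_pred z); first by rewrite e ep in eS.
  by rewrite addn0 addnC; apply: leq_trans (leq_addr _ _); case: (_ && _).
have [yz|yz] := eqVneq y z.
  rewrite yz eS /=; have [e|//] := eqVneq z (ord_pred z).
  by move: eS; rewrite {1}e ord_predK ez.
have -> : (ordS y == z) = (y == ord_pred z).
  by apply/eqP/eqP => [<-|->]; rewrite ?ordSK ?ord_predK.
have [->|_] := eqVneq y (ord_pred z); first by rewrite eS andbF ord_predK ep ez.
by rewrite (inj_eq (@ordS_inj N)) (negPf yz).
Qed.

Lemma particle_pair_left eta z y : jump_left eta z ->
  (particle_pair (swap eta z) y + (y == ordS z)
    <= particle_pair eta y + (y == ord_pred z))%N.
Proof.
rewrite /jump_left /particle_pair !swapE => /and3P[/negPf ez eS eSS].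
have [->|ySz] := eqVneq y (ordS z).
  have [e|_] := eqVneq (ordS z) z; first by rewrite e ez in eS.
  by rewrite ez eS eSS.
have [yz|yz] := eqVneq y z.
  rewrite yz; have -> : (ordS z == z) = false.
    by apply/eqP => e; rewrite e ez in eS.
  by rewrite eqxx ez andbF.
have -> : (ordS y == z) = (y == ord_pred z).
  by apply/eqP/eqP => [<-|->]; rewrite ?ordSK ?ord_predK.
have [->|_] := eqVneq y (ord_pred z); first by rewrite addnC leq_add // leq_b1.
by rewrite (inj_eq (@ordS_inj N)) (negPf yz).
Qed.

Lemma sum_ordS (F : 'I_N -> nat) : (\sum_x F (ordS x) = \sum_x F x)%N.
Proof.
by rewrite [RHS](reindex (@ordS N)) //; exists (@ord_pred N) => i _;
  rewrite ?ordSK ?ord_predK.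
Qed.

(** Twice the number of particles is the sum over all bonds of the number of
    particles at their ends.  If each bond has at least one and some bond has
    two, this exceeds [N]; if each has at most one and some bond has none, it
    is below [N]. *)
Lemma transient_pairs eta : transient eta ->
  (exists x, hole_pair eta x) /\ (exists y, particle_pair eta y).
Proof.
have twice : (2 * nb_particles eta = \sum_x (eta x + eta (ordS x)))%N.
  by rewrite big_split /= (sum_ordS (fun x => nat_of_bool (eta x))) addnn mul2n.
have cardN : N = (\sum_(x < N) 1)%N by rewrite sum1_card card_ord.
case=> -[/existsNP[x0 ex0]].
- rewrite twice [X in (_ <= X)%N -> _]cardN => le.
  have px0 : particle_pair eta x0.
    by move: ex0; rewrite /particle_pair; do 2?case: (eta _).
  split; last by exists x0.
  apply: contrapT => /forallNP nh; move: le; apply/negP; rewrite -ltnNge.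
  rewrite (bigD1 x0) //= [X in (_ < X)%N](bigD1 x0) //=.
  have /andP[p0 p1] := px0.
  rewrite -addSn leq_add ?p0 ?p1 //.
  apply: leq_sum => x _; move: (nh x); rewrite /hole_pair.
  by do 2?case: (eta _).
- rewrite twice [X in (X <= _)%N -> _]cardN => le.
  have hx0 : hole_pair eta x0.
    by move: ex0; rewrite /hole_pair; do 2?case: (eta _).
  split; first by exists x0.
  apply: contrapT => /forallNP nh; move: le; apply/negP; rewrite -ltnNge.
  rewrite (bigD1 x0) //= [X in (_ < X)%N](bigD1 x0) //=.
  have /andP[/negPf h0 /negPf h1] := hx0.
  rewrite -addSn leq_add ?h0 ?h1 //.
  apply: leq_sum => x _; move: (nh x); rewrite /particle_pair.
  by do 2?case: (eta _).
Qed.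

End Jumps.

(** * The Lyapunov function and its drift *)

(** The factor [1 - e] of a jump rate expands into pairs [p] and triples [q];
    pairs are compared at indices [k] and [k + 2], between which the coefficient
    decreases by [8], and triples at consecutive indices, between which it
    decreases by [4].  All boundary terms vanish on the cut ring, where [e]
    is zero at [0], [1], [n + 1] and [n + 2]. *)
Lemma summation_by_parts (R : comRingType) (a : R) (e : nat -> R) (n : nat) :
  let p k := e k * e k.+1 in
  let q k := e k * e k.+1 * e k.+2 in
  \sum_(k < n) (a - 4 * k.+1%:R) *
      (p k * (1 - e k.+2) - (1 - e k.+1) * e k.+2 * e k.+3)
  = \sum_(k < n) (4 * q k - 8 * p k)
    + ((a + 4) * p 0 + a * p 1 - a * q 0)
    - ((a - 4 * n%:R + 4) * p n + (a - 4 * n%:R) * (p n.+1 - q n)).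
Proof.
move=> p q; elim: n => [|n IHn]; first by rewrite !big_ord0; ring.
by rewrite !big_ord_recr /= {}IHn /p /q -natr1; ring.
Qed.

Section Potential.
Context {R : realType} {N : nat}.
Implicit Types (eta : config N) (x y z : 'I_N).

(** A quadratic weight has constant second differences, so that the summation
    by parts leaves constant coefficients. *)
Definition weight (k : nat) : R := k%:R * (N%:R - k%:R).

Definition pair_weight x eta : R :=
  \sum_(k < N) weight k * (particle_pair eta (site x k))%:R.

Definition potential eta : R :=
  \sum_x (hole_pair eta x)%:R * pair_weight x eta.

Lemma weight_ge0 (k : nat) : (k <= N)%N -> 0 <= weight k.
Proof. by move=> kN; rewrite mulr_ge0 // subr_ge0 ler_nat. Qed.

Lemma weight_le (k : nat) : (k <= N)%N -> weight k <= N%:R ^+ 2.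
Proof.
by move=> kN; rewrite expr2 ler_pM ?subr_ge0 ?ler_nat ?gerBl.
Qed.

Lemma pair_weight_ge0 x eta : 0 <= pair_weight x eta.
Proof. by apply: sumr_ge0 => k _; rewrite mulr_ge0 ?weight_ge0 // ltnW. Qed.

Lemma potential_ge0 eta : 0 <= potential eta.
Proof. by apply: sumr_ge0 => x _; rewrite mulr_ge0 ?pair_weight_ge0. Qed.

Lemma potential_le eta : potential eta <= N%:R ^+ 4.
Proof.
have pw x : pair_weight x eta <= N%:R ^+ 3.
  apply: (@le_trans _ _ (\sum_(k < N) N%:R ^+ 2)).
    apply: ler_sum => k _; have kN := ltnW (ltn_ord k).
    by case: (particle_pair _ _); rewrite ?mulr1 ?mulr0 ?weight_le // exprn_ge0.
  by rewrite sumr_const card_ord -[_ *+ N]mulr_natl -exprS.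
apply: (@le_trans _ _ (\sum_(x < N) N%:R ^+ 3)).
  apply: ler_sum => x _.
  by case: (hole_pair _ _); rewrite ?mul1r ?mul0r ?pw // exprn_ge0.
by rewrite sumr_const card_ord -[_ *+ N]mulr_natl -exprS.
Qed.

Lemma potential_ge1 eta : transient eta -> 1 <= potential eta.
Proof.
move=> /transient_pairs[[x hx] [y hy]].
rewrite /potential (bigD1 x) //= hx mul1r -[1]addr0 lerD //; last first.
  by apply: sumr_ge0 => i _; rewrite mulr_ge0 ?pair_weight_ge0.
have [k yk] := siteP x y.
rewrite /pair_weight (bigD1 k) //= -yk hy mulr1 -[1]addr0 lerD //; last first.
  by apply: sumr_ge0 => i _; rewrite mulr_ge0 ?weight_ge0 // ltnW.
have k0 : (0 < k)%N.
  rewrite lt0n; apply/eqP => k0; move: hx hy.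
  by rewrite yk k0 /hole_pair /particle_pair => /andP[/negPf ->].
rewrite /weight -natrB ?(ltnW (ltn_ord k)) // -natrM ler1n muln_gt0 k0.
by rewrite subn_gt0 /=.
Qed.

(** The case [k = N] is included, although [site x N] is [x]: the weight takes
    the same value at both ends of the cut ring. *)
Lemma sum_weight_site (x : 'I_N) (k : nat) : (k <= N)%N ->
  \sum_(j < N) weight j * (site x j == site x k)%:R = weight k.
Proof.
rewrite leq_eqVlt => /predU1P[->|kN].
  rewrite site_size {2}/weight subrr mulr0 big1 // => j _.
  rewrite -[in X in _ == X](erefl : site x 0 = x) site_eq //; last first.
    exact: leq_ltn_trans (ltn_ord j).
  by case: eqP => [->|_]; rewrite ?mulr0 // /weight mul0r mul0r.
rewrite (bigD1 (Ordinal kN)) //= eqxx mulr1 big1 ?addr0 // => j jk.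
by rewrite site_eq // -[k]/(nat_of_ord (Ordinal kN)) val_eqE (negPf jk) mulr0.
Qed.

Lemma pair_weight_move x eta eta' (a b : nat) : (a <= N)%N -> (b <= N)%N ->
  (forall y, particle_pair eta' y + (y == site x a)
     <= particle_pair eta y + (y == site x b))%N ->
  pair_weight x eta' - pair_weight x eta <= weight b - weight a.
Proof.
move=> aN bN le; rewrite lerBlDr addrAC lerBrDr [leRHS]addrC.
rewrite -(sum_weight_site x aN) -(sum_weight_site x bN) -!big_split /=.
apply: ler_sum => j _; rewrite -!mulrDr -!natrD ler_wpM2l ?ler_nat //.
by rewrite weight_ge0 // ltnW.
Qed.

Lemma hole_pair_rate x eta z : ~~ hole_pair eta x ->
  rate eta z * (hole_pair (swap eta z) x)%:R = 0 :> R.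
Proof.
move=> hx; rewrite rateE -natrD.
have [j|] := boolP (jump_right eta z || jump_left eta z).
  by rewrite (contraNF (hole_pair_swap j) hx) mulr0.
by rewrite negb_or => /andP[/negPf -> /negPf ->]; rewrite mul0r.
Qed.

(** A jump over the bond at [x + k + 1] moves a particle pair between
    [x + k] and [x + k + 2].  A jump into the hole pair at [x] needs no special
    treatment, as losing the hole pair only lowers the left side. *)
Lemma jump_bound x eta (k : nat) : hole_pair eta x -> (k.+2 <= N)%N ->
  rate eta (site x k.+1) *
    ((hole_pair (swap eta (site x k.+1)) x)%:R
        * pair_weight x (swap eta (site x k.+1)) - pair_weight x eta)
  <= (2 * N%:R - 4 * k.+1%:R) * ((jump_right eta (site x k.+1))%:R
        - (jump_left eta (site x k.+1))%:R) :> R.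
Proof.
move=> hx kN; rewrite rateE; set z := site x k.+1; set eta' := swap eta z.
have drop : (hole_pair eta' x)%:R * pair_weight x eta' - pair_weight x eta
    <= pair_weight x eta' - pair_weight x eta.
  by rewrite lerB // ler_piMl ?pair_weight_ge0 ?lern1 ?leq_b1.
have ez : ord_pred z = site x k by rewrite /z siteS ordSK.
have zS : ordS z = site x k.+2 by [].
have dw : weight k.+2 - weight k = 2 * N%:R - 4 * k.+1%:R :> R.
  by rewrite /weight -!natr1; ring.
have kN' : (k <= N)%N by lia.
have [jr|_] := boolP (jump_right eta z).
  have -> : jump_left eta z = false.
    by move: jr; rewrite /jump_right /jump_left => /and3P[_ -> _].
  rewrite addr0 mul1r subr0 mulr1 -dw; apply: le_trans drop _.
  by apply: pair_weight_move => // y;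
    rewrite -ez -zS; exact: particle_pair_right.
have [jl|_] := boolP (jump_left eta z); last by rewrite addr0 mul0r subr0 mulr0.
rewrite add0r mul1r sub0r mulrN1 -dw opprB; apply: le_trans drop _.
by apply: pair_weight_move => // y; rewrite -ez -zS; exact: particle_pair_left.
Qed.

(** Each triple contains a particle pair, so the summation by parts leaves at
    most [- 8 + 4] per pair. *)
Lemma jumps_seen_from_hole_pair x eta : (2 <= N)%N -> hole_pair eta x ->
  \sum_z rate eta z * ((hole_pair (swap eta z) x)%:R
      * pair_weight x (swap eta z) - pair_weight x eta)
  <= - 4 * \sum_(k < N) (particle_pair eta (site x k))%:R :> R.
Proof.
move=> N2 hx; pose e k : R := (eta (site x k))%:R.
have [n Nn] : exists n, N = n.+1 by exists N.-1; rewrite prednK // ltnW.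
have /andP[/negPf x0 /negPf x1] := hx.
have e0 : e 0%N = 0 by rewrite /e /= x0.
have e1 : e 1%N = 0 by rewrite /e /= x1.
have eN : e n.+1 = 0 by rewrite /e -Nn site_size x0.
have eN1 : e n.+2 = 0 by rewrite /e siteS -Nn site_size x1.
have ppE k : (particle_pair eta (site x k))%:R = e k * e k.+1.
  by rewrite /particle_pair -siteS /e -natrM mulnb.
pose drift z := rate eta z * ((hole_pair (swap eta z) x)%:R
  * pair_weight x (swap eta z) - pair_weight x eta) : R.
rewrite -/(\sum_z drift z) (sum_site x drift).
under [X in _ <= - 4 * X]eq_bigr do rewrite ppE.
have reindexN (F : nat -> R) : \sum_(k < N) F k = \sum_(k < n.+1) F k.
  by rewrite Nn.
rewrite (reindexN (fun k => drift (site x k))).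
rewrite (reindexN (fun k => e k * e k.+1)).
(* the first bond joins the two sites of the hole pair: no jump crosses it *)
rewrite big_ord_recl [X in X + _](_ : _ = 0); last first.
  by rewrite /drift /= rateE /jump_right /jump_left x0 x1 /= andbF addr0 mul0r.
rewrite add0r big_ord_recr /= eN mulr0 addr0.
apply: (@le_trans _ _ (\sum_(k < n) (2 * N%:R - 4 * k.+1%:R) *
    (e k * e k.+1 * (1 - e k.+2) - (1 - e k.+1) * e k.+2 * e k.+3))).
  apply: ler_sum => k _.
  have kN : (k.+2 <= N)%N by rewrite Nn !ltnS.
  apply: le_trans (jump_bound hx kN) _.
  have -> : (jump_right eta (site x k.+1))%:R
      = e k * e k.+1 * (1 - e k.+2) :> R.
    rewrite /jump_right -siteS {1}siteS ordSK /e.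
    by do 3?case: (eta _) => //=; ring.
  have -> : (jump_left eta (site x k.+1))%:R
      = (1 - e k.+1) * e k.+2 * e k.+3 :> R.
    rewrite /jump_left -!siteS /e.
    by do 3?case: (eta _) => //=; ring.
  exact: lexx.
rewrite summation_by_parts e0 e1 eN eN1 !(mul0r, mulr0, subr0, addr0).
rewrite mulr_sumr; apply: ler_sum => k _.
rewrite /e; do 3?case: (eta _); rewrite ?(mul0r, mulr0, mulr1); lra.
Qed.

Lemma pair_weight_le x eta :
  pair_weight x eta
    <= N%:R ^+ 2 * \sum_(k < N) (particle_pair eta (site x k))%:R :> R.
Proof.
rewrite mulr_sumr; apply: ler_sum => k _.
by rewrite ler_wpM2r // weight_le // ltnW.
Qed.

Lemma generator_potential eta : (2 <= N)%N ->
  FEP_generator potential eta <= - (4 / N%:R ^+ 2) * potential eta :> R.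
Proof.
move=> N2; rewrite /FEP_generator.
under eq_bigr do rewrite /potential -sumrB mulr_sumr.
rewrite exchange_big /= /potential mulr_sumr; apply: ler_sum => x _.
have [hx|hx] := boolP (hole_pair eta x); last first.
  rewrite mul0r mulr0 big1 // => z _; rewrite subr0 mulrA.
  by rewrite hole_pair_rate // mul0r.
rewrite mul1r; apply: le_trans (jumps_seen_from_hole_pair _ _) _ => //.
have M0 : 0 < N%:R ^+ 2 :> R by rewrite exprn_gt0 // ltr0n ltnW.
have := pair_weight_le x eta.
move: (N%:R ^+ 2) M0 (\sum_(k < N) _) (pair_weight _ _) => M M0 s w ws.
have -> : - 4 * s = - (4 / M) * (M * s) by field; rewrite gt_eqF.
by rewrite ler_wnM2l // oppr_le0 divr_ge0 // ltW.
Qed.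

End Potential.

(** * Transience probability *)

Lemma transience_bound (R : realType) (d : measure_display)
    (Omega : measurableType d) (N : nat) (X : R -> Omega -> config N)
    (P : config N -> probability Omega R) (eta : config N) (t : R) :
  markov_process FEP_generator X P -> (2 <= N)%N -> 0 < t ->
  (transience_proba X P eta t
    <= (expR (- (4 / N%:R ^+ 2 * t)) * N%:R ^+ 4)%:E)%E.
Proof.
move=> MP N2 t0; rewrite /transience_proba.
rewrite (transition_event MP _ _ (ltW t0)) lee_fin.
apply: (@le_trans _ _ (transition (X := X) (P := P) t potential eta)).
  apply: transition_le => xi; rewrite indicE.
  have [/set_mem tr|_] := boolP (xi \in _); first exact: potential_ge1.
  exact: potential_ge0.
have c0 : 0 <= 4 / N%:R ^+ 2 :> R by rewrite divr_ge0 // exprn_ge0.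
apply: le_trans (transition_decay MP eta c0 t0 potential_ge0 _) _.
  by move=> xi; exact: generator_potential.
by rewrite ler_wpM2l ?expR_ge0 // potential_le.
Qed.

Unset Implicit Arguments.

Theorem theorem2p1 (R : realType) (d : nat -> measure_display)
  (Omega : forall N : nat, measurableType (d N))
  (X : forall N : nat, R -> Omega N -> config N)
  (P : forall N : nat, config N -> probability (Omega N) R)
  (FEP : forall N : nat, (1 <= N)%N ->
     markov_process FEP_generator (X N) (P N)) :
  ereal_sup [set max_transience_proba (X N) (P N) (t * N%:R ^+ 2 * ln N%:R)
            | N in [set N : nat | (2 <= N)%N]]
    @[t --> +oo] --> 0%E.
Proof.
have ln2 : 0 < ln 2 :> R by rewrite ln_gt0 // ltr1n.
apply: (@squeeze_cvge _ _ _ _ (cst 0%E) _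
  (fun t => (expR (- ((4 * t - 4) * ln 2)))%:E)).
- near=> t; have t1 : 1 <= t by near: t; exact: nbhs_pinfty_ge.
  apply/andP; split.
    apply: le_trans (ereal_sup_ubound _); last by exists 2.
    apply: le_trans (ereal_sup_ubound _); last by exists [ffun=> false].
    exact: measure_ge0.
  apply: ge_ereal_sup => _ [N /= N2 <-].
  apply: ge_ereal_sup => _ [eta _ <-].
  have N0 : 0 < N%:R :> R by rewrite ltr0n ltnW.
  have lnN : ln 2 <= ln N%:R :> R by rewrite ler_ln ?posrE // ler_nat.
  have lnN0 : 0 < ln N%:R :> R := lt_le_trans ln2 lnN.
  apply: le_trans (transience_bound eta _ N2 _) _.
  - by apply: FEP; exact: ltnW.
  - by rewrite !mulr_gt0 ?exprn_gt0 // (lt_le_trans ltr01).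
  (* [N ^ 4] absorbed into the exponential: [N ^ (4 - 4 t)] *)
  rewrite lee_fin -[X in _ * X ^+ 4]lnK // -expRM_natl -expRD ler_expR.
  rewrite (_ : 4 / _ * _ = 4 * t * ln N%:R); last first.
    by field; rewrite gt_eqF.
  rewrite -mulr_natr; nra.
- exact: cvg_cst.
apply: cvg_EFin; first exact: nearW.
apply: (cvg_comp _ (fun u => expR (- u)) (G := +oo%R)); last exact: cvgr_expR.
apply/cvgryPge => A; near=> t.
by rewrite -ler_pdivrMr // lerBrDr [4 * t]mulrC -ler_pdivrMr //.
Unshelve. all: by end_near. Qed.
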